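(* For each $0<\alpha<1$ and any cube $\mathfrak{Q}\subseteq\mathsf{T}_d$ we have: (i) for $d=2$, $$\dim\mathcal{E}_{\alpha,2}(\mathfrak{Q})\ge\min\{3/2,\ 3(1-\alpha)\};$$ (ii) for every integer $d\ge 3$, $$\dim\mathcal{E}_{\alpha,d}(\mathfrak{Q})\ge\min\{\kappa_d,\ 2\kappa_d(1-\alpha)\}.$$
   Context: Write $\mathbf{e}(x)=\exp(2\pi i x)$. $\mathsf{T}_d=(\mathbb{R}/\mathbb{Z})^d$ is the $d$-dimensional unit torus, identified with $[0,1)^d$. For $\mathbf{x}=(x_1,\dots,x_d)\in\mathsf{T}_d$ and $N\in\mathbb{N}$, let $$S_d(\mathbf{x};N)=\sum_{n=1}^{N}\mathbf{e}(x_1n+\dots+x_dn^d),$$ $$\mathcal{E}_{\alpha,d}=\{\mathbf{x}\in\mathsf{T}_d:\ |S_d(\mathbf{x};N)|\ge N^{\alpha}\text{ for infinitely many }N\in\mathbb{N}\},\qquad \mathcal{E}_{\alpha,d}(\mathfrak{Q})=\mathcal{E}_{\alpha,d}\cap\mathfrak{Q}.$$ Cubes are axis-parallel with positive side length. $\dim$ denotes the Hausdorff dimension, and $$\kappa_d=\max_{\nu=1,\dots,d}\ \min\left\{\frac{1}{2\nu},\ \frac{1}{2d-\nu}\right\}.$$ *)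

(* Defs.v *)
From HB Require Import structures.
From mathcomp Require Import all_boot all_order all_algebra.
From mathcomp Require Import complex.
From mathcomp Require Import all_classical all_reals all_analysis.

Set Implicit Arguments.
Unset Strict Implicit.
Unset Printing Implicit Defensive.

Import Order.TTheory GRing.Theory Num.Theory.

Local Open Scope classical_set_scope.
Local Open Scope ring_scope.

Section Hausdorff.
Context {R : realType} {X : Type} (dist : X -> X -> R).

(* The element 0 only matters for A = set0, where the bare supremum would
   be -oo. *)
Definition diam (A : set X) : \bar R :=
  ereal_sup (0%E |` [set (dist p.1 p.2)%:E | p in A `*` A]).

(* H^s_delta: countable covers by arbitrary sets of diameter at most delta. *)
Definition hausdorff_premeasure (s delta : R) (A : set X) : \bar R :=
  ereal_inf [set (\sum_(0 <= i <oo) poweR (diam (U i)) s)%E | U in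
    [set U : nat -> set X | A `<=` \bigcup_i U i /\
                            forall i, (diam (U i) <= delta%:E)%E]].

(* The limit as delta tends to 0+ is a supremum, since H^s_delta is
   nonincreasing in delta.  Only meant for s > 0: at s = 0 every infinite
   cover would have infinite sum, because 0 `^ 0 = 1. *)
Definition hausdorff_measure (s : R) (A : set X) : \bar R :=
  ereal_sup [set hausdorff_premeasure s delta A | delta in
    [set delta : R | 0 < delta]].

Definition hausdorff_dim (A : set X) : \bar R :=
  ereal_inf [set s%:E | s in
    [set s : R | 0 < s /\ hausdorff_measure s A = 0%E]].

End Hausdorff.

Section WeylSums.
Context {R : realType}.

(* The library norm on 'rV[R]_d is the sup norm. *)
Definition euclidean_dist d (x y : 'rV[R]_d) : R :=
  Num.sqrt (\sum_(j < d) (x ord0 j - y ord0 j) ^+ 2).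

Definition torus d : set 'rV[R]_d :=
  [set x | forall j, 0 <= x ord0 j < 1].

(* Each face of the cube may or may not belong to it: BSide true a and
   BSide false a are the two kinds of interval bounds at a. *)
Definition is_cube d (Q : set 'rV[R]_d) : Prop :=
  exists (a : 'rV[R]_d) (l : R) (b c : 'I_d -> bool), 0 < l /\
    Q = [set x | forall j, x ord0 j \in
          Interval (BSide (b j) (a ord0 j)) (BSide (c j) (a ord0 j + l))].

Definition e (x : R) : R[i] := Complex (cos (2 * pi * x)) (sin (2 * pi * x)).

(* Coordinates are numbered from 0, so x ord0 j is the coefficient of
   n ^ (j + 1). *)
Definition weyl_sum d (x : 'rV[R]_d) (N : nat) : R[i] :=
  \sum_(1 <= n < N.+1) e (\sum_(j < d) x ord0 j * n%:R ^+ j.+1).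

Definition large_weyl_set (alpha : R) d : set 'rV[R]_d :=
  [set x | torus x /\
    infinite_set [set N : nat | N%:R `^ alpha <= Normc.normc (weyl_sum x N)]].

(* All the values are positive for 1 <= d, so the default 0 is harmless. *)
Definition kappa (d : nat) : R :=
  \big[Num.max/0]_(1 <= nu < d.+1)
    Num.min (1 / (2 * nu%:R)) (1 / (2 * d%:R - nu%:R)).

End WeylSums.

Arguments torus {R} d.
Arguments large_weyl_set {R} alpha d.
Arguments euclidean_dist {R} d.

(* Main.v *)
Require Import Defs.
From HB Require Import structures.
From mathcomp Require Import all_boot all_order all_algebra.
From mathcomp Require Import complex.
From mathcomp Require Import all_classical all_reals all_analysis.
From mathcomp Require Import ring lra zify.

(** The lower bounds come from points that lie very close to rational points
with an exceptionally large complete exponential sum.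

Let p be a prime not dividing d, k a natural number and q = p^(dk). There are
many rational points r of denominator q for which the complete sum
S(r; q) has absolute value exactly p^((d-1)k) = q^(1-1/d):
- for d = 2 every r = (a/q, b/q) with b prime to the odd number q, by the
  evaluation of the quadratic Gauss sum (normc_quadratic_gauss_sum);
- for d >= 3 every r whose last coordinate is c/q with c prime to p and whose
  other coordinates have denominators dividing p^k, by the recursion n -> p n
  (sum_sparse_poly).
Hence |S(r; N)| = N p^(-k) for every multiple N of q. If x satisfies
|x_j - r_j| <= c N^(-j) for all j = 1, ..., d, with a small constant c, then
summation by parts passes from x to r: the factor e((r - x)(n)) has bounded
variation on [1, N], so |S(r; N)| <= 2 max_(M <= N) |S(x; M)|
(weyl_sum_nearby). It is essential to go in this direction. The reverse
inequality would require bounds for incomplete sums at r, whereas here some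
M <= N satisfies |S(x; M)| >= N p^(-k) / 2, and once this is at least
N^alpha it is at least M^alpha; since |S(x; M)| <= M, these M are unbounded
(large_weyl_set_nearby).

Take q = p^(dAn) and N = p^(Bn) with A/B < 1 - alpha and dA <= B, so that
N p^(-An) = N^(1-A/B) exceeds 2 N^alpha. Points admitting such approximations
for infinitely many n are produced one coordinate at a time by a Cantor
construction along a very sparse sequence of n. Keeping a fixed proportion of
the fractions a/q with a = 1 mod p in the previous interval, and attaching to
each of them an interval of length about N^(-j), gives a Cantor set of dimension
dA/(jB)
(cantor_near_rationals). For d = 2 both coordinates vary and the dimensions
2A/B and A/B add up to 3A/B, which is as close to 3(1 - alpha) as desired when
alpha >= 1/2. For d >= 3 only the last coordinate varies, and the dimension A/B
may be any number below min(1/d, 1 - alpha); this suffices because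
kappa_d <= 3/(4d) (kappa_le). The case alpha < 1/2 reduces to alpha = 1/2.

The Hausdorff dimension is bounded below without constructing a measure
(hausdorff_measure_gt0). The points of the Cantor set are parametrized by their
digits, that is, by a map h on [0,1) with |u - v| <= C |h u - h v|^theta for
every theta below the dimension. A cover of the image of [0,1)^2 under such
maps pulls back to a cover of the unit square by rectangles of area
O(diam^(theta_1 + theta_2)), and countable subadditivity of the planar Lebesgue
measure bounds the sum of diam^(theta_1 + theta_2) from below. *)

Set Implicit Arguments.
Unset Strict Implicit.
Unset Printing Implicit Defensive.

Import Order.TTheory GRing.Theory Num.Theory.
Import numFieldNormedType.Exports.

Local Open Scope classical_set_scope.
Local Open Scope ring_scope.

(** * The function e and summation by parts *)

Lemma eD (R : realType) (x y : R) : e (x + y) = e x * e y.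
Proof.
rewrite /e mulrDr cosD sinD; apply/eqP; rewrite eq_complex /=.
by rewrite eqxx /= addrC [_ * sin _]mulrC [sin _ * _]mulrC eqxx.
Qed.

Lemma e0 (R : realType) : e (0 : R) = 1.
Proof. by rewrite /e mulr0 cos0 sin0. Qed.

Lemma e_nat (R : realType) (n : nat) : e (n%:R : R) = 1.
Proof.
elim: n => [|n IH]; first exact: e0.
rewrite -natr1 eD IH mul1r /e mulr1 mulr_natl cos2pi sin2pi //.
Qed.

Lemma normc_e (R : realType) (x : R) : Normc.normc (e x) = 1.
Proof. by rewrite /= cos2Dsin2 sqrtr1. Qed.

Lemma ler_normcD (R : realType) (x y : R[i]) :
  Normc.normc (x + y) <= Normc.normc x + Normc.normc y.
Proof. exact: le_normcD. Qed.

Lemma normc_ge0 (R : realType) (x : R[i]) : 0 <= Normc.normc x.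
Proof. by case: x => a b; exact: sqrtr_ge0. Qed.

Lemma ler_normc_sum (R : realType) (I : Type) (r : seq I) (P : pred I)
    (F : I -> R[i]) :
  Normc.normc (\sum_(i <- r | P i) F i)
    <= \sum_(i <- r | P i) Normc.normc (F i).
Proof.
elim/big_rec2: _ => [|i y x _ h]; first by rewrite Normc.normc0.
by apply: le_trans (ler_normcD _ _) _; rewrite lerD2l.
Qed.

Lemma normc_le_ReDIm (R : realType) (a b : R) :
  Normc.normc (Complex a b) <= `|a| + `|b|.
Proof.
have h0 : 0 <= `|a| + `|b| by exact: addr_ge0.
rewrite /= -(ger0_norm h0) -sqrtr_sqr ler_sqrt ?sqr_ge0//.
rewrite sqrrD !real_normK ?num_real// -addrA lerD2l lerDr.
by rewrite mulrn_wge0 // mulr_ge0.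
Qed.

Lemma cos_lipschitz (R : realType) (x y : R) : `|cos x - cos y| <= `|x - y|.
Proof.
wlog xy : x y / x <= y => [h|].
  have [xy|/ltW yx] := leP x y; first exact: h.
  by rewrite distrC (distrC x); exact: h.
rewrite distrC (distrC x).
have [|c _ ->] := @MVT_segment R cos (fun z => - sin z) x y xy; last first.
  by rewrite normrM normrN ler_piMl // sin_max.
exact/continuous_subspaceT/continuous_cos.
Qed.

Lemma sin_lipschitz (R : realType) (x y : R) : `|sin x - sin y| <= `|x - y|.
Proof.
rewrite -!cosBpihalf; apply: le_trans (cos_lipschitz _ _) _.
by rewrite opprB addrA subrK.
Qed.

Lemma normc_e_sub (R : realType) (x y : R) :
  Normc.normc (e x - e y) <= 4 * pi * `|x - y|.
Proof.
rewrite (_ : e x - e y = Complex (cos (2 * pi * x) - cos (2 * pi * y))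
   (sin (2 * pi * x) - sin (2 * pi * y))) //.
apply: le_trans (normc_le_ReDIm _ _) _.
apply: le_trans (lerD (cos_lipschitz _ _) (sin_lipschitz _ _)) _.
rewrite -mulrBr normrM (ger0_norm (_ : 0 <= 2 * pi)) ?mulr_ge0 ?pi_ge0 //.
lra.
Qed.

(** If the weights w have modulus one, multiplying by them increases the partial
sums of z by at most the factor 1 + Var(w): this is Abel's identity, with the
increments of w estimated in absolute value. *)
Lemma normc_sum_by_parts (R : realType) (z w : nat -> R[i]) (B : R) (N : nat) :
  (forall n, Normc.normc (w n) = 1) ->
  (forall M, (M <= N)%N -> Normc.normc (\sum_(1 <= n < M.+1) z n) <= B) ->
  Normc.normc (\sum_(1 <= n < N.+1) z n * w n) <=
  B * (1 + \sum_(1 <= n < N) Normc.normc (w n.+1 - w n)).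
Proof.
move=> w1 zB.
have B0 : 0 <= B.
  by apply: le_trans (zB 0%N isT); rewrite normc_ge0.
have -> : \sum_(1 <= n < N.+1) z n * w n = (\sum_(1 <= n < N.+1) z n) * w N
   - \sum_(1 <= n < N) (\sum_(1 <= m < n.+1) z m) * (w n.+1 - w n).
  elim: N {zB} => [|N IH]; first by rewrite !big_geq // mul0r subr0.
  rewrite big_nat_recr //= IH [X in _ = X * _ - _]big_nat_recr //=.
  case: N {IH} => [|N]; first by rewrite !(@big_geq _ _ _ 1 1) //; ring.
  by rewrite [X in _ = _ - X]big_nat_recr //=; ring.
rewrite mulrDr mulr1; apply: le_trans (ler_normcD _ _) _.
apply: lerD; first by rewrite Normc.normcM w1 mulr1 zB.
rewrite normcN; apply: le_trans (ler_normc_sum _ _ _) _.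
rewrite mulr_sumr big_nat_cond [leRHS]big_nat_cond.
apply: ler_sum => n /andP[/andP[_ nN] _].
by rewrite Normc.normcM ler_wpM2r ?normc_ge0 // zB // ltnW.
Qed.

(** * Weyl sums at nearby points *)

(** The terms at r are the terms at x times e((r - x)(n)). The total variation of
this factor on [1, N] telescopes to at most 4 pi sum_j |x_j - r_j| N^(j+1),
because each n^(j+1) is increasing in n. *)
Lemma weyl_sum_nearby (R : realType) (d : nat) (x r : 'rV[R]_d) (N : nat) :
  4 * pi * (\sum_(j < d) `|x ord0 j - r ord0 j| * N%:R ^+ j.+1) <= 1 ->
  exists2 M, (M <= N)%N &
    Normc.normc (weyl_sum r N) <= 2 * Normc.normc (weyl_sum x M).
Proof.
move=> hx.
pose F (i : 'I_N.+1) := Normc.normc (weyl_sum x i).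
have [i _ hi] := @arg_maxP _ _ _ ord0 xpredT F isT.
exists i; first by rewrite -ltnS.
pose w n := e (\sum_(j < d) (r ord0 j - x ord0 j) * n%:R ^+ j.+1).
have -> : weyl_sum r N = \sum_(1 <= n < N.+1)
    e (\sum_(j < d) x ord0 j * n%:R ^+ j.+1) * w n.
  apply: eq_bigr => n _; rewrite /w -eD -big_split /=; congr e.
  by apply: eq_bigr => j _; rewrite -mulrDl addrC subrK.
apply: le_trans (normc_sum_by_parts (B := F i) _ _) _.
- by move=> n; exact: normc_e.
- by move=> M MN; exact: (hi (Ordinal (MN : (M < N.+1)%N)) isT).
rewrite [leRHS]mulrC ler_wpM2l ?normc_ge0 //.
rewrite (_ : 2 = 1 + 1 :> R) // lerD2l.
apply: le_trans hx; rewrite mulr_sumr.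
have hw n : Normc.normc (w n.+1 - w n) <= \sum_(j < d)
    (4 * pi * `|x ord0 j - r ord0 j|) * (n.+1%:R ^+ j.+1 - n%:R ^+ j.+1).
  apply: le_trans (normc_e_sub _ _) _.
  rewrite -sumrB; under [leRHS]eq_bigr do rewrite -mulrA.
  rewrite -mulr_sumr ler_wpM2l ?mulr_ge0 ?pi_ge0 //.
  apply: le_trans (ler_norm_sum _ _ _) _; apply: ler_sum => j _.
  rewrite -mulrBr normrM distrC ler_wpM2l // ger0_norm // subr_ge0.
  by rewrite lerXn2r ?nnegrE ?ler0n // ler_nat.
apply: le_trans (ler_sum _ (fun n _ => hw n)) _.
rewrite exchange_big /=; apply: ler_sum => j _.
rewrite -mulr_sumr mulrA ler_wpM2l ?mulr_ge0 ?pi_ge0 //.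
case: N {F i hi w hw} => [|N]; first by rewrite big_geq // expr0n /=.
by rewrite telescope_sumr // lerBlDr lerDl exprn_ge0.
Qed.

Lemma weyl_sum_le (R : realType) (d : nat) (x : 'rV[R]_d) (N : nat) :
  Normc.normc (weyl_sum x N) <= N%:R.
Proof.
apply: le_trans (ler_normc_sum _ _ _) _.
under eq_bigr do rewrite normc_e.
by rewrite sumr_const_nat subn1.
Qed.

(** The M found near each N satisfies |S(x; M)| >= N^alpha >= M^alpha. These M are
unbounded because M >= |S(x; M)| >= N^alpha >= K. *)
Lemma large_weyl_set_nearby (R : realType) (alpha : R) (d : nat)
    (x : 'rV[R]_d) :
  0 < alpha -> torus d x ->
  (forall K : nat, exists (N : nat) (r : 'rV[R]_d),
    [/\ K%:R <= N%:R `^ alpha,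
      2 * N%:R `^ alpha <= Normc.normc (weyl_sum r N) &
      4 * pi * (\sum_(j < d) `|x ord0 j - r ord0 j| * N%:R ^+ j.+1) <= 1]) ->
  large_weyl_set alpha d x.
Proof.
move=> a0 tx h; split=> //.
suff hK K : exists2 M, (K <= M)%N &
    M%:R `^ alpha <= Normc.normc (weyl_sum x M).
  move=> /finite_seqP[s sE].
  have [M KM hM] := hK (\max_(i <- s) i).+1.
  have : [set` s] M by rewrite -sE.
  move=> /= Ms; have := @leq_bigmax_seq _ s xpredT id M Ms isT.
  by rewrite leqNgt KM.
have [N [r [KN Nr /weyl_sum_nearby[M MN hM]]]] := h K.
have NM : N%:R `^ alpha <= Normc.normc (weyl_sum x M).
  by have := le_trans Nr hM; rewrite ler_pM2l.
exists M.
  by rewrite -(ler_nat R); apply: le_trans (le_trans KN NM) (weyl_sum_le _ _).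
apply: le_trans NM; apply: ge0_ler_powR; rewrite ?nnegrE ?ler0n //.
  exact: ltW.
by rewrite ler_nat.
Qed.

(** * Complete exponential sums *)

Definition residue_char (R : realType) (q n : nat) : R[i] :=
  e (n%:R / q%:R).

Lemma residue_charD (R : realType) (q m n : nat) :
  residue_char R q (m + n) = residue_char R q m * residue_char R q n.
Proof. by rewrite /residue_char natrD mulrDl eD. Qed.

Lemma residue_char0 (R : realType) (q : nat) : residue_char R q 0 = 1.
Proof. by rewrite /residue_char mul0r e0. Qed.

Lemma residue_char_dvd (R : realType) (q n : nat) :
  (q %| n)%N -> residue_char R q n = 1.
Proof.
move=> /dvdnP[k ->]; case: q => [|q]; first by rewrite muln0 residue_char0.
by rewrite /residue_char natrM mulfK ?pnatr_eq0 // e_nat.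
Qed.

Lemma residue_char_mod (R : realType) (q m n : nat) :
  m = n %[mod q] -> residue_char R q m = residue_char R q n.
Proof.
move=> mn; rewrite (divn_eq m q) (divn_eq n q) !residue_charD mn.
by rewrite !(@residue_char_dvd R q (_ * q)) ?dvdn_mull.
Qed.

Lemma residue_char_mul2 (R : realType) (a q n : nat) :
  (0 < a)%N -> residue_char R (a * q) (a * n) = residue_char R q n.
Proof.
move=> a0; rewrite /residue_char !natrM -mulf_div divff ?mul1r //.
by rewrite pnatr_eq0 -lt0n.
Qed.

Lemma residue_char_mulX (R : realType) (q t v : nat) :
  residue_char R q (t * v) = residue_char R q t ^+ v.
Proof.
elim: v => [|v IH]; first by rewrite muln0 residue_char0.
by rewrite mulnS residue_charD IH exprS.
Qed.

(** For 0 < x < 1 the real part of e(x) is 1 - 2 sin(pi x)^2 < 1. *)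
Lemma e_neq1 (R : realType) (x : R) : 0 < x < 1 -> e x != 1.
Proof.
move=> /andP[x0 x1]; apply/eqP => /(congr1 (@complex.Re R)) /= h.
have s0 : 0 < sin (pi * x).
  by apply: sin_gt0_pi; rewrite mulr_gt0 ?pi_gt0 //= gtr_pMr ?pi_gt0.
have h2 : cos (2 * pi * x) = 1 - sin (pi * x) ^+ 2 *+ 2.
  have -> : 2 * pi * x = (pi * x) *+ 2 by ring.
  by rewrite cos_mulr2n cos2sin2; ring.
by have := exprn_gt0 2 s0; move: h; rewrite h2; lra.
Qed.

Lemma residue_char_neq1 (R : realType) (q t : nat) :
  (0 < q)%N -> ~~ (q %| t)%N -> residue_char R q t != 1.
Proof.
move=> q0 qt; rewrite (@residue_char_mod _ q t (t %% q)) ?modn_mod //.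
apply: e_neq1; rewrite divr_gt0 ?ltr0n // ?lt0n //=.
by rewrite ltr_pdivrMr ?ltr0n // mul1r ltr_nat ltn_mod.
Qed.

Lemma sum_residue_char (R : realType) (q t : nat) : (0 < q)%N ->
  \sum_(0 <= v < q) residue_char R q (t * v) = ((q %| t)%N * q)%:R.
Proof.
move=> q0; case: (boolP (q %| t)%N) => qt.
  rewrite mul1n; under eq_bigr do rewrite residue_char_dvd ?dvdn_mulr //.
  by rewrite sumr_const_nat subn0.
rewrite mul0n; under eq_bigr do rewrite residue_char_mulX.
have := subrX1 (residue_char R q t) q.
rewrite -residue_char_mulX residue_char_dvd ?dvdn_mull // subrr => /esym/eqP.
rewrite mulf_eq0 subr_eq0 (negbTE (residue_char_neq1 R q0 qt)) /= => /eqP h.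
by rewrite big_mkord h.
Qed.

(** Every n < m p is uniquely u + m v with u < m and v < p. *)
Lemma sum_nat_mul (V : zmodType) (F : nat -> V) (m p : nat) :
  \sum_(0 <= n < m * p) F n =
  \sum_(0 <= v < p) \sum_(0 <= u < m) F (u + m * v)%N.
Proof.
elim: p => [|p IH]; first by rewrite muln0 !big_geq.
rewrite big_nat_recr //= -IH mulnS addnC (@big_cat_nat _ _ _ (m * p)) ?leq_addr //=.
congr (_ + _); rewrite -{1}[(m * p)%N]add0n big_addn addKn.
by apply: eq_bigr => i _.
Qed.

Lemma sum_periodic_shift (V : zmodType) (F : nat -> V) (q m : nat) :
  (forall n, F (n + q)%N = F n) ->
  \sum_(0 <= n < q) F (m + n)%N = \sum_(0 <= n < q) F n.
Proof.
move=> Fq; elim: m => [|m IH]; first exact: eq_bigr.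
rewrite -[RHS]IH; case: q Fq {IH} => [|q] Fq; first by rewrite !big_geq.
rewrite big_nat_recr //= [RHS]big_nat_recl //= addrC; congr (_ + _).
  by rewrite addSnnS Fq addn0.
by apply: eq_bigr => i _; rewrite addSnnS.
Qed.

Lemma sum_periodic_mul (R : realType) (F : nat -> R[i]) (q L : nat) :
  (forall n, F (n + q)%N = F n) ->
  \sum_(0 <= n < q * L) F n = L%:R * \sum_(0 <= n < q) F n.
Proof.
move=> Fq; rewrite sum_nat_mul.
have Fqv v u : F (u + q * v)%N = F u.
  elim: v => [|v IH]; first by rewrite muln0 addn0.
  by rewrite mulnSr addnA Fq.
under eq_bigr do under eq_bigr do rewrite Fqv.
by rewrite sumr_const_nat subn0 mulr_natl.
Qed.

(** At a rational point the terms are periodic, so that a sum over L periods is L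
times the complete sum; starting at n = 1 instead of n = 0 is a shift. *)
Lemma weyl_sum_rational (R : realType) (d : nat) (r : 'rV[R]_d) (f : nat -> nat)
    (q L : nat) :
  (forall n : nat, \sum_(j < d) r ord0 j * n%:R ^+ j.+1 = (f n)%:R / q%:R) ->
  (forall n, f (n + q) = f n %[mod q])%N ->
  weyl_sum r (q * L) = L%:R * \sum_(0 <= n < q) residue_char R q (f n).
Proof.
move=> hr fq.
have Fq n : residue_char R q (f (n + q)%N) = residue_char R q (f n).
  exact: residue_char_mod.
rewrite -(sum_periodic_mul (F := fun n => residue_char R q (f n))) //.
rewrite -(@sum_periodic_shift _ (fun n => residue_char R q (f n)) _ 1); last first.
  move=> n; elim: L => [|L IH]; first by rewrite muln0 addn0.
  by rewrite mulnSr addnA Fq.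
rewrite /weyl_sum big_add1 /=.
by apply: eq_bigr => n _; rewrite /residue_char -hr add1n.
Qed.

Lemma normc_sqr (R : realType) (z : R[i]) :
  ((Normc.normc z ^+ 2)%:C)%C = z * z^*%C.
Proof.
case: z => a b /=; rewrite sqr_sqrtr ?addr_ge0 ?sqr_ge0 //.
by apply/eqP; rewrite eq_complex /=; apply/andP; split; apply/eqP; ring.
Qed.

Lemma mul_conjc_e (R : realType) (x : R) : e x * (e x)^*%C = 1.
Proof. by rewrite -normc_sqr normc_e expr1n. Qed.

(** Squaring out and substituting n = m + h, the sum over m becomes
the sum of the character m -> e(2bhm/q), which vanishes unless h = 0. *)
Lemma normc_quadratic_gauss_sum (R : realType) (a b q : nat) : (0 < q)%N ->
  coprime q (2 * b) ->
  Normc.normc (\sum_(0 <= n < q) residue_char R q (a * n + b * n ^ 2)) ^+ 2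
    = q%:R.
Proof.
move=> q0 qb; set S := \sum_(_ <= _ < _) _.
pose f n := (a * n + b * n ^ 2)%N.
have fq n : residue_char R q (f (n + q)%N) = residue_char R q (f n).
  rewrite (_ : f (n + q)%N = f n + q * (a + 2 * b * n + b * q))%N; last first.
    by rewrite /f; ring.
  by rewrite residue_charD [X in _ * X]residue_char_dvd ?dvdn_mulr ?mulr1.
apply: complexI.
rewrite normc_sqr {2}/S rmorph_sum /= mulr_sumr.
under eq_bigr => m _.
  rewrite /S -(sum_periodic_shift m fq) mulr_suml.
  under eq_bigr => h _.
    have -> : f (m + h)%N = (f m + (f h + 2 * b * h * m))%N by rewrite /f; ring.
    rewrite residue_charD mulrAC mul_conjc_e mul1r residue_charD.
    over.
  over.
rewrite exchange_big /=; under eq_bigr => h _ do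
  rewrite -mulr_sumr sum_residue_char //.
have -> : \sum_(0 <= h < q) residue_char R q (f h) * ((q %| 2 * b * h) * q)%:R
    = q%:R :> R[i].
  case: q q0 qb {S fq} => // q _ qb.
  rewrite big_nat_recl // big_nat_cond big1 => [|h /andP[/andP[_ hq] _]].
    by rewrite muln0 dvdn0 mul1n addr0 /f !muln0 residue_char0 mul1r.
  by rewrite Gauss_dvdr // gtnNdvd // mul0n mulr0.
by rewrite rmorph_nat.
Qed.

Lemma expnD_sqr (u x n : nat) : exists K,
  ((u + x) ^ n.+1 = u ^ n.+1 + n.+1 * u ^ n * x + x ^ 2 * K)%N.
Proof.
elim: n => [|n [K hK]]; first by exists 0%N; rewrite !expn1 expn0; ring.
exists ((u + x) * K + n.+1 * u ^ n)%N.
by rewrite expnS hK !expnS -(addn1 n.+1); ring.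
Qed.

(** After multiplication by q = p^((D+1)k), the phase of a rational point whose top
coordinate is c/q and whose other coordinates are g_j/p^k. This shape is
preserved by n -> p n, with k replaced by k - 1. *)
Definition sparse_poly (p c D k : nat) (g : nat -> nat) (n : nat) : nat :=
  (c * n ^ D.+1 + p ^ (D * k) * \sum_(j < D) g j * n ^ j.+1)%N.

Lemma modnXD (n q i : nat) : ((n + q) ^ i = n ^ i %[mod q])%N.
Proof. by rewrite -modnXm modnDr modnXm. Qed.

Lemma modnS_sum (q D : nat) (F G : nat -> nat) :
  (forall j, F j = G j %[mod q])%N ->
  (\sum_(j < D) F j = \sum_(j < D) G j %[mod q])%N.
Proof.
move=> h; rewrite -[LHS]modn_summ -[RHS]modn_summ; congr (_ %% _)%N.
by apply: eq_bigr => j _; exact: h.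
Qed.

Lemma sparse_poly_periodic (p c D k : nat) g (q n : nat) :
  (sparse_poly p c D k g (n + q) = sparse_poly p c D k g n %[mod q])%N.
Proof.
have hM a x y : (x = y %[mod q] -> a * x = a * y %[mod q])%N.
  by move=> h; rewrite -modnMmr h modnMmr.
rewrite /sparse_poly -modnDm (hM c _ _ (modnXD _ _ _)).
rewrite (hM (p ^ (D * k))%N _ (\sum_(j < D) g j * n ^ j.+1)%N) ?modnDm //.
apply: (@modnS_sum q D (fun j => g j * (n + q) ^ j.+1)%N
   (fun j => g j * n ^ j.+1)%N) => j; exact/hM/modnXD.
Qed.

(** Modulo p^((D+1)(k+1)), shifting by a multiple of p^((D+1)(k+1)-1) only affects
the linear term of the Taylor expansion of the leading monomial. *)
Lemma sparse_poly_shift (p c D k : nat) g (u v : nat) : (0 < p)%N -> (0 < D)%N ->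
  let m := (p ^ (D.+1 * k + D))%N in
  (sparse_poly p c D k.+1 g (u + m * v) =
   sparse_poly p c D k.+1 g u + m * (c * D.+1 * u ^ D * v)
     %[mod p ^ (D.+1 * k.+1)])%N.
Proof.
move=> p0 D0 m; set q := (p ^ (D.+1 * k.+1))%N.
have hM a x y : (x = y %[mod q] -> a * x = a * y %[mod q])%N.
  by move=> h; rewrite -modnMmr h modnMmr.
have qm2 : (q %| m ^ 2)%N by rewrite -expnM dvdn_exp2l //; nia.
have qm : (q %| p ^ (D * k.+1) * m)%N by rewrite -expnD dvdn_exp2l //; nia.
have [K hK] := expnD_sqr u (m * v) D.
rewrite /sparse_poly hK [in RHS]addnAC.
rewrite (_ : c * (u ^ D.+1 + D.+1 * u ^ D * (m * v) + (m * v) ^ 2 * K) =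
   m ^ 2 * (c * v ^ 2 * K) + (c * u ^ D.+1 + m * (c * D.+1 * u ^ D * v)))%N;
  last by rewrite expnMn; ring.
rewrite -addnA -modnDml (eqP (dvdn_mulr _ qm2)) add0n.
rewrite -modnDmr -[in RHS]modnDmr; congr ((_ + _) %% q)%N.
rewrite !big_distrr /=.
apply: (@modnS_sum q D (fun j => p ^ (D * k.+1) * (g j * (u + m * v) ^ j.+1))%N
  (fun j => p ^ (D * k.+1) * (g j * u ^ j.+1))%N) => j.
have [K' ->] := expnD_sqr u (m * v) j.
rewrite (_ : p ^ (D * k.+1) *
    (g j * (u ^ j.+1 + j.+1 * u ^ j * (m * v) + (m * v) ^ 2 * K'))
  = p ^ (D * k.+1) * m * (g j * (j.+1 * u ^ j * v + m * v ^ 2 * K'))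
   + p ^ (D * k.+1) * (g j * u ^ j.+1))%N; last by rewrite expnMn; ring.
by rewrite -modnDml (eqP (dvdn_mulr _ qm)) add0n.
Qed.

Lemma sparse_poly_mulp (p c D k : nat) g (w : nat) :
  (sparse_poly p c D k.+1 g (p * w) =
   p ^ D.+1 * sparse_poly p c D k (fun j => g j * p ^ j) w)%N.
Proof.
rewrite /sparse_poly expnMn mulnDr; congr (_ + _)%N; first by ring.
rewrite !big_distrr /= ; apply: eq_bigr => j _.
by rewrite mulnS expnD expnMn !expnS; ring.
Qed.

(** For k >= 1 write n = u + m v with m = p^((D+1)k-1) and v < p. By
sparse_poly_shift, the sum over v is a complete sum modulo p of the character
with frequency c (D+1) u^D: it vanishes unless p divides u, in which case it
contributes p. The remaining u = p w < m run over p^(D-1) periods of the phase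
for k - 1. *)
Lemma sum_sparse_poly (R : realType) (p c D k : nat) (g : nat -> nat) :
  prime p -> coprime p (c * D.+1) -> (0 < D)%N ->
  \sum_(0 <= n < p ^ (D.+1 * k))
    residue_char R (p ^ (D.+1 * k)) (sparse_poly p c D k g n)
  = (p ^ (D * k))%:R.
Proof.
move=> pp pc D0; have p0 := prime_gt0 pp.
elim: k g => [|k IH] g.
  by rewrite !muln0 !expn0 big_nat1 residue_char_dvd ?dvd1n.
set q := (p ^ (D.+1 * k.+1))%N; set m := (p ^ (D.+1 * k + D))%N.
have qE : q = (m * p)%N by rewrite /q /m -expnSr; congr (_ ^ _)%N; ring.
rewrite [X in index_iota _ X]qE sum_nat_mul exchange_big /=.
under eq_bigr => u _.
  under eq_bigr => v _.
    rewrite (residue_char_mod R (sparse_poly_shift c k g u v p0 D0)).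
    rewrite residue_charD -/q -/m qE residue_char_mul2 ?expn_gt0 ?p0 // -qE; over.
  rewrite -mulr_sumr sum_residue_char //.
  rewrite Gauss_dvdr // Euclid_dvdX // D0 andbT; over.
have -> : m = (p * (p ^ (D.+1 * k) * p ^ D.-1))%N.
  rewrite /m -expnD -expnS; congr (_ ^ _)%N; lia.
rewrite sum_nat_mul; under eq_bigr => w _.
  rewrite big_ltn // add0n dvdn_mulr // mul1n.
  rewrite big_nat_cond big1 ?addr0; last first.
    move=> i /andP[/andP[i0 ip] _]; rewrite dvdn_addl ?dvdn_mulr //.
    by rewrite gtnNdvd // mul0n mulr0.
  rewrite sparse_poly_mulp /q mulnS expnD residue_char_mul2 ?expn_gt0 ?p0 //; over.
rewrite -mulr_suml sum_periodic_mul; last first.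
  by move=> n; apply/residue_char_mod/sparse_poly_periodic.
rewrite IH -!natrM; congr _%:R.
by rewrite mulnS expnD -{3}(prednK D0) expnS; ring.
Qed.

(** * A Cantor set parametrized by mixed-radix digits *)

Section CantorMap.
Context {R : realType} (off y0 theta : R) (Q rho : nat -> R).

(** Number of children kept in a cell of level k: half of what fits, which leaves
room for rounding and for the length of the child cells. *)
Definition branching k : nat := Num.truncn (rho k * Q k.+1 / 2).

(** The first component is the left endpoint of the level-k cell containing the
point attached to u; the second is what is left of u, rescaled to [0,1), from
which the later digits are read. The digit c selects a child whose left endpoint
is (i + off) / Q k, where i ranges over consecutive integers. *)
Fixpoint cantor_state (u : R) (k : nat) : R * R :=
  if k is k'.+1 then
    let: (y, t) := cantor_state u k' in
    let c := Num.truncn (t * (branching k')%:R) in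
    ((((Num.truncn (y * Q k)).+1 + c)%:R + off) / Q k,
     t * (branching k')%:R - c%:R)
  else (y0, u).

Definition cantor_point (u : R) : R :=
  sup (range (fun k => (cantor_state u k).1)).

(** The bound rhoQ_le keeps sibling cells apart, rhoQ_ge leaves room for several
children in every cell, and rhoQ_exp makes the number of children of a cell
exceed the negative power rho k.+1 `^ (- theta) of their length. *)
Context (off01 : 0 <= off <= 1) (y0_ge0 : 0 <= y0) (theta01 : 0 <= theta <= 1)
  (rho_gt0 : forall k, 0 < rho k) (Q_gt0 : forall k, 0 < Q k)
  (rhoQ_le : forall k, 2 * rho k.+1 * Q k.+1 <= 1)
  (rhoQ_ge : forall k, 8 <= rho k * Q k.+1)
  (rhoQ_exp : forall k, 4 <= rho k.+1 `^ theta * (rho k * Q k.+1)).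

Lemma branching_bounds k :
  [/\ 2 <= (branching k)%:R :> R, (branching k)%:R + 2 <= rho k * Q k.+1 &
    rho k * Q k.+1 <= 4 * (branching k)%:R].
Proof.
have h8 := rhoQ_ge k; have h0 : 0 <= rho k * Q k.+1 / 2 by lra.
have /andP[h1 h2] := truncn_itv h0; rewrite -/(branching k) in h1 h2.
rewrite -[(branching k).+1%:R]natr1 in h2; split; lra.
Qed.

Lemma truncn_bounds (x : R) : 0 <= x ->
  (Num.truncn x)%:R <= x < (Num.truncn x)%:R + 1.
Proof. by move=> /truncn_itv; rewrite -natr1. Qed.

Lemma cantor_state_itv u k : 0 <= u < 1 ->
  0 <= (cantor_state u k).1 /\ 0 <= (cantor_state u k).2 < 1.
Proof.
move=> u01; elim: k => [|k] /=; first by split.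
case: cantor_state => y t /= [y_ge0 /andP[t0 t1]].
have [b2 _ _] := branching_bounds k.
have tm0 : 0 <= t * (branching k)%:R by rewrite mulr_ge0.
have /andP[h1 h2] := truncn_bounds tm0.
split; last by apply/andP; split; lra.
have /andP[off_ge0 _] := off01; by rewrite divr_ge0 ?addr_ge0 // ltW.
Qed.

Lemma cantor_state_nested u k : 0 <= u < 1 ->
  (cantor_state u k).1 <= (cantor_state u k.+1).1 /\
  (cantor_state u k.+1).1 + rho k.+1 <= (cantor_state u k).1 + rho k.
Proof.
move=> u01; have := cantor_state_itv k u01; rewrite /=.
case: cantor_state => y t /= [y_ge0 /andP[t0 t1]].
have [b2 b3 _] := branching_bounds k.
have Q0 := Q_gt0 k.+1.
have tm0 : 0 <= t * (branching k)%:R by rewrite mulr_ge0.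
have /andP[h1 _] := truncn_bounds tm0.
have /andP[h3 h4] := truncn_bounds (mulr_ge0 y_ge0 (ltW Q0)).
have /andP[off_ge0 off_le1] := off01.
have c1 : (Num.truncn (t * (branching k)%:R))%:R + 1 <= (branching k)%:R :> R.
  rewrite natr1 ler_nat -(ltr_nat R); apply: le_lt_trans h1 _.
  by rewrite gtr_pMl //; lra.
rewrite natrD -[X in X + _ + _]natr1; set a := (Num.truncn _)%:R in h3 h4 *.
set c := (Num.truncn _)%:R in h1 c1 *.
have c0 : 0 <= c by rewrite /c.
split; first by rewrite ler_pdivlMr //; lra.
rewrite -lerBrDr ler_pdivrMr // mulrBl mulrDl.
have := rhoQ_le k; lra.
Qed.

Lemma cantor_state_homo u k j : 0 <= u < 1 -> (k <= j)%N ->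
  (cantor_state u k).1 <= (cantor_state u j).1 /\
  (cantor_state u j).1 + rho j <= (cantor_state u k).1 + rho k.
Proof.
move=> u01 /subnK <-; elim: (j - k)%N => [|i [h1 h2]]; first by rewrite add0n.
have [h3 h4] := cantor_state_nested (i + k) u01.
by rewrite addSn; split; [exact: le_trans h1 h3|exact: le_trans h4 h2].
Qed.

Lemma cantor_point_itv u k : 0 <= u < 1 ->
  (cantor_state u k).1 <= cantor_point u <= (cantor_state u k).1 + rho k.
Proof.
move=> u01.
have ub k' : ubound (range (fun k => (cantor_state u k).1))
    ((cantor_state u k').1 + rho k').
  move=> _ [j _ <-]; have [jk|/ltnW kj] := leqP j k'.
    have [h1 h2] := cantor_state_homo u01 jk.
    by apply: le_trans h1 _; rewrite lerDl ltW.
  have [h1 h2] := cantor_state_homo u01 kj.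
  by apply: le_trans _ h2; rewrite lerDl ltW.
apply/andP; split; last first.
  by apply: ge_sup (ub k); exists (cantor_state u k).1; exists k.
apply: ub_le_sup; last by exists k.
by exists ((cantor_state u k).1 + rho k); exact: ub.
Qed.

Lemma cantor_point_approx u k : 0 <= u < 1 -> exists j : nat,
  (j%:R + off) / Q k.+1 <= cantor_point u <= (j%:R + off) / Q k.+1 + rho k.+1.
Proof.
move=> /(cantor_point_itv k.+1) /=; case: cantor_state => y t.
by set j := (_.+1 + _)%N; exists j.
Qed.

Definition cell_count k : nat := (\prod_(i < k) branching i)%N.

Lemma cell_countS k : (cell_count k.+1 = cell_count k * branching k)%N.
Proof. exact: big_ord_recr. Qed.

Lemma cell_count_gt k : (2 ^ k <= cell_count k)%N.
Proof.
elim: k => [|k IH]; first by rewrite /cell_count big_ord0.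
rewrite cell_countS expnSr leq_mul // -(ler_nat R).
by have [] := branching_bounds k.
Qed.

(** At levels k >= 1 the growth condition lets the last branching number alone
compensate rho k `^ theta; the last factor takes care of the single cell of
level 0, whose length rho 0 is arbitrary. *)
Lemma cell_count_exp k :
  1 <= rho k `^ theta * (cell_count k)%:R * (1 + rho 0 `^ (- theta)).
Proof.
have p0 : 0 <= rho 0 `^ (- theta) by exact: powR_ge0.
case: k => [|k].
  rewrite /cell_count big_ord0 mulr1 mulrDr -powRD ?subrr ?powRr0 //.
    by rewrite lerDr mulr1 powR_ge0.
  by rewrite eqxx /= gt_eqF.
rewrite -[leLHS]mulr1; apply: ler_pM => //; last by rewrite lerDl.
have [_ _ h] := branching_bounds k.
rewrite -(@ler_pM2r _ 4) // mul1r -mulrA; apply: le_trans (rhoQ_exp k) _.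
rewrite ler_wpM2l ?powR_ge0 //; apply: le_trans h _.
rewrite [leLHS]mulrC ler_pM2r //. rewrite ler_nat cell_countS leq_pmull //.
by apply: leq_trans (cell_count_gt k); rewrite expn_gt0.
Qed.

Lemma truncated_powR (x z : R) : 0 < x -> z <= 1 -> z <= x -> z <= x `^ theta.
Proof.
have /andP[t0 t1] := theta01.
move=> x0 z1 zx; have [x1|/ltW x1] := leP x 1.
  by apply: le_trans zx (ger1_powR _ _); rewrite ?x0.
by apply: le_trans z1 _; rewrite -(powRr0 x); apply: ler_powR.
Qed.

(** Let k be the last level at which u and v lie in the same cell, with digits
c <> c' at the next level, and put j = |c - c'|. Then |u - v| is at most 2j divided
by the number of cells of level k+1, while the points are at least j/(2 Q_(k+1))
apart. Eliminating j, |u - v| times the number of cells of level k is at most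
min(1, 16 r / rho_k) <= (16 r / rho_k)^theta, where r is the distance of the points.
If there is no such level, all digits agree and u = v. *)
Lemma cantor_point_separation (u v : R) : 0 <= u < 1 -> 0 <= v < 1 ->
  `|u - v| <=
  16 * (1 + rho 0 `^ (- theta)) * `|cantor_point u - cantor_point v| `^ theta.
Proof.
move=> u01 v01; set C := (X in _ <= X).
have C0 : 0 <= C by rewrite !mulr_ge0 ?addr_ge0 ?powR_ge0.
have /andP[t0 t1] := theta01.
rewrite leNgt; apply/negP => Cuv.
have P k : (cantor_state u k).1 = (cantor_state v k).1 /\
    (cantor_state u k).2 - (cantor_state v k).2 = (u - v) * (cell_count k)%:R.
  elim: k => [|k [yE tE]]; first by rewrite /cell_count big_ord0 mulr1.
  have [_ /andP[u'0 u'1]] := cantor_state_itv k.+1 u01.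
  have [_ /andP[v'0 v'1]] := cantor_state_itv k.+1 v01.
  have [_ /andP[ut0 ut1]] := cantor_state_itv k u01.
  have [_ /andP[vt0 vt1]] := cantor_state_itv k v01.
  have /andP[hu hu'] := cantor_point_itv k.+1 u01.
  have /andP[hv hv'] := cantor_point_itv k.+1 v01.
  have [b2 b3 b4] := branching_bounds k.
  have Q0 := Q_gt0 k.+1; have r0 := rho_gt0 k.
  move: hu hu' hv hv' u'0 u'1 v'0 v'1 ut0 ut1 vt0 vt1 yE tE => /=.
  case: cantor_state => y t; case: cantor_state => y' t' /=.
  set c := Num.truncn (t * _); set c' := Num.truncn (t' * _).
  move=> hu hu' hv hv' u'0 u'1 v'0 v'1 ut0 ut1 vt0 vt1 yE tE.
  subst y'.
  set cu := (X in X <= cantor_point u) in hu hu'.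
  set cv := (X in X <= cantor_point v) in hv hv'.
  rewrite -/cu in hu'; rewrite -/cv in hv'.
  have [cc|cc] := eqVneq c c'.
    rewrite cc; split => //; rewrite cell_countS natrM mulrA -tE; ring.
  exfalso; move: Cuv; apply/negP; rewrite -leNgt.
  pose r : R := `|cantor_point u - cantor_point v|; rewrite -/r.
  pose j : R := `|c%:R - c'%:R|.
  have j1 : 1 <= j.
    rewrite /j; move: cc; rewrite neq_ltn => /orP[] lt_cc.
      by rewrite distrC ger0_norm ?subr_ge0 ?ler_nat 1?ltnW // lerBrDl natr1 ler_nat.
    by rewrite ger0_norm ?subr_ge0 ?ler_nat 1?ltnW // lerBrDl natr1 ler_nat.
  have M0 : 0 < (cell_count k)%:R :> R.
    by rewrite ltr0n; apply: leq_trans (cell_count_gt k); rewrite expn_gt0.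
  have jr : j <= 2 * Q k.+1 * r.
    have jE : j = Q k.+1 * `|cu - cv|.
      rewrite -[X in X * _]ger0_norm ?(ltW Q0) // -normrM; congr `|_|.
      by rewrite /cu /cv !natrD; field; rewrite gt_eqF.
    have cr : `|cu - cv| <= r + rho k.+1.
      rewrite ler_norml.
      have : cantor_point u - cantor_point v <= r by exact: ler_norm.
      have : cantor_point v - cantor_point u <= r.
        by rewrite /r distrC; exact: ler_norm.
      by move=> ? ?;  apply/andP; split; lra.
    have := ler_wpM2l (ltW Q0) cr; rewrite -jE mulrDr.
    have := rhoQ_le k; lra.
  have tj : `|t - t'| * (branching k)%:R <= 2 * j.
    have -> : `|t - t'| * (branching k)%:R = `|(t - t') * (branching k)%:R|.
      by rewrite normrM normr_nat.
    have := ler_norm (c%:R - c'%:R : R); have := lerNnormlW (lexx j).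
    rewrite -/j => ? ?.
    by rewrite ler_norml; apply/andP; split; lra.
  have r_gt0 : 0 < r.
    have : 0 < Q k.+1 * r by lra.
    by rewrite pmulr_rgt0.
  have uvM : `|u - v| * (cell_count k)%:R = `|t - t'|.
    by rewrite tE normrM normr_nat.
  have hmin : `|t - t'| <= (16 * r / rho k) `^ theta.
    apply: truncated_powR; first by rewrite divr_gt0 // mulr_gt0.
      by rewrite ler_norml; apply/andP; split; lra.
    rewrite ler_pdivlMr //.
    rewrite -(ler_pM2r Q0) -mulrA.
    apply: (@le_trans _ _ (`|t - t'| * (4 * (branching k)%:R))).
      by rewrite ler_wpM2l.
    lra.
  rewrite -(ler_pM2r M0) uvM; apply: le_trans hmin _.
  rewrite !powRM ?invr_ge0 ?mulr_ge0 ?(ltW r_gt0) ?(ltW r0) //.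
  have -> : C = 16 * (1 + rho 0 `^ (- theta)) * r `^ theta by [].
  rewrite -(powR_inv1 (ltW r0)) -powRrM mulN1r (powRN (rho k)).
  have p0 : 0 < rho k `^ theta by exact: powR_gt0.
  rewrite ler_pdivrMr //.
  have h16 : 16 `^ theta <= 16 :> R by apply: ler1_powR => //; lra.
  apply: (@le_trans _ _ (16 * r `^ theta)); first by rewrite ler_wpM2r ?powR_ge0.
  have h := ler_wpM2l (mulr_ge0 (ler0n R 16) (powR_ge0 r theta)) (cell_count_exp k).
  rewrite mulr1 in h; apply: le_trans h _.
  by rewrite le_eqVlt; apply/orP; left; apply/eqP; ring.
have d0 : 0 < `|u - v| by exact: le_lt_trans C0 Cuv.
pose K := (Num.truncn (`|u - v|^-1)).+1.
have [_ uvK] := P K.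
have [_ /andP[u'0 u'1]] := cantor_state_itv K u01.
have [_ /andP[v'0 v'1]] := cantor_state_itv K v01.
have : `|u - v| * (cell_count K)%:R < 1.
  rewrite -(normr_nat R (cell_count K)) -normrM -uvK ltr_norml.
  by apply/andP; split; lra.
apply/negP; rewrite -leNgt.
have h : `|u - v|^-1 <= (cell_count K)%:R.
  apply: (@le_trans _ _ K%:R).
    by have /truncn_itv/andP[_ /ltW] : 0 <= `|u - v|^-1 by rewrite invr_ge0.
  rewrite ler_nat; apply: leq_trans (cell_count_gt K).
  by apply: ltnW; exact: ltn_expl.
by have := ler_wpM2l (ltW d0) h; rewrite divff ?gt_eqF.
Qed.

End CantorMap.

(** * Lower bounds for the Hausdorff dimension *)

Lemma dist_le_diam (R : realType) (X : Type) (dist : X -> X -> R) (U : set X)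
    (x y : X) : U x -> U y -> ((dist x y)%:E <= diam dist U)%E.
Proof.
by move=> Ux Uy; apply: ereal_sup_ubound; right; exists (x, y).
Qed.

Lemma diam_ge0 (R : realType) (X : Type) (dist : X -> X -> R) (U : set X) :
  (0 <= diam dist U)%E.
Proof. by apply: ereal_sup_ubound; left. Qed.

Lemma measurable_box (R : realType) (a b c d : R) :
  measurable ((`[a, b] `*` `[c, d]) : set (R * R)).
Proof. by apply: measurableX; exact: measurable_itv. Qed.

Lemma lebesgue_box (R : realType) (x y r1 r2 : R) : 0 <= r1 -> 0 <= r2 ->
  (@lebesgue_measure R \x @lebesgue_measure R)%E
    ((`[x - r1, x + r1] `*` `[y - r2, y + r2]) : set (R * R))
  = (2 * r1 * (2 * r2))%:E.
Proof.
have len z r : 0 <= r ->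
    lebesgue_measure (`[z - r, z + r]%classic : set R) = (2 * r)%:E.
  move=> r0; rewrite lebesgue_measure_itv /= lte_fin.
  case: ltP => [_|h]; first by rewrite -EFinD; congr _%:E; ring.
  by rewrite (_ : r = 0) ?mulr0 //; lra.
move=> r10 r20; rewrite product_measure1E; [|exact: measurable_itv..].
by rewrite EFinM; congr (_ * _)%E; exact: len.
Qed.

(** The preimage under H of a set of diameter D is contained in a box with sides
2 C D^t1 and 2 C D^t2. These boxes cover the unit square, so the sum of
4 C^2 D^(t1+t2) over a cover of A is at least 1. *)
Lemma hausdorff_measure_gt0 (R : realType) (X : Type) (dist : X -> X -> R)
    (A : set X) (H : R -> R -> X) (C t1 t2 : R) :
  (forall x y, 0 <= dist x y) -> 0 <= C -> 0 <= t1 -> 0 <= t2 -> 0 < t1 + t2 ->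
  (forall u v : R, 0 <= u < 1 -> 0 <= v < 1 -> A (H u v)) ->
  (forall u v u' v' : R, 0 <= u < 1 -> 0 <= v < 1 -> 0 <= u' < 1 -> 0 <= v' < 1 ->
    `|u - u'| <= C * dist (H u v) (H u' v') `^ t1 /\
    `|v - v'| <= C * dist (H u v) (H u' v') `^ t2) ->
  (0 < hausdorff_measure dist (t1 + t2) A)%E.
Proof.
move=> d0 C0 t10 t20 t0 HA Hd; set s := t1 + t2.
(* The summand 1 makes K positive even if C = 0. *)
pose K : R := 4 * C ^+ 2 + 1.
have K0 : 0 < K by rewrite ltr_wpDl // mulr_ge0 // sqr_ge0.
apply: (@lt_le_trans _ _ (K^-1)%:E); first by rewrite lte_fin invr_gt0.
apply: (@le_trans _ _ (hausdorff_premeasure dist s 1 A)); last first.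
  by apply: ereal_sup_ubound; exists 1 => //=.
apply: le_ereal_inf_tmp => _ /= [U [AU U1] <-].
have box i : exists B : set (R * R), [/\ measurable B,
    forall u v, 0 <= u < 1 -> 0 <= v < 1 -> U i (H u v) -> B (u, v) &
    ((@lebesgue_measure R \x @lebesgue_measure R)%E B <=
      K%:E * poweR (diam dist (U i)) s)%E].
  have [[u [v [u01 v01 Uuv]]]|noU] := pselect (exists u v,
      [/\ 0 <= u < 1, 0 <= v < 1 & U i (H u v)]); last first.
    exists set0; split; first exact: measurable0.
      by move=> u v u01 v01 Uuv; apply: noU; exists u, v.
    by rewrite measure0 mule_ge0 ?poweR_ge0 // lee_fin ltW.
  have := U1 i; have := diam_ge0 dist (U i); have := @dist_le_diam _ _ dist (U i).
  case: (diam dist (U i)) => [D| |] // hD; rewrite lee_fin => D0 _.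
  exists (`[u - C * D `^ t1, u + C * D `^ t1] `*` `[v - C * D `^ t2, v + C * D `^ t2]).
  split; first exact: measurable_box.
    move=> u' v' u'01 v'01 Uuv'; have [h1 h2] := Hd _ _ _ _ u01 v01 u'01 v'01.
    have dD t : 0 <= t -> C * dist (H u v) (H u' v') `^ t <= C * D `^ t.
      move=> t_ge0; rewrite ler_wpM2l // ge0_ler_powR ?nnegrE // -lee_fin.
      exact: hD.
    have := le_trans h1 (dD _ t10); have := le_trans h2 (dD _ t20).
    rewrite !ler_norml => /andP[? ?] /andP[? ?].
    by split; rewrite /= in_itv /=; apply/andP; split; lra.
  rewrite lebesgue_box ?mulr_ge0 ?powR_ge0 // poweR_EFin -EFinM lee_fin.
  rewrite powRD; last by rewrite gt_eqF.
  have p1 := powR_ge0 D t1; have p2 := powR_ge0 D t2.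
  have := mulr_ge0 p1 p2; rewrite /K; nra.
have [B hB] := choice box.
have : (1%:E <= \sum_(0 <= i <oo) (K%:E * poweR (diam dist (U i)) s))%E.
  have E1 : (@lebesgue_measure R \x @lebesgue_measure R)%E
      ((`[0, 1[ `*` `[0, 1[) : set (R * R)) = 1%:E.
    rewrite product_measure1E; [|exact: measurable_itv..].
    have len1 : lebesgue_measure (`[0, 1[%classic : set R) = 1%:E.
      by rewrite lebesgue_measure_itv /= lte_fin ltr01 sube0.
    by rewrite -[RHS]mule1; congr (_ * _)%E; exact: len1.
  rewrite -E1; apply: (@le_trans _ _ (\sum_(0 <= i <oo)
      (@lebesgue_measure R \x @lebesgue_measure R)%E (B i))%E).
    apply: measure_sigma_subadditive => //.
    - by move=> i; have [] := hB i.
    - by apply: measurableX; exact: measurable_itv.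
    - move=> [u v] [/=]; rewrite !in_itv /= => u01 v01.
      have [i _ Ui] := AU _ (HA _ _ u01 v01).
      by exists i => //; have [_ h _] := hB i; exact: h.
  apply: lee_nneseries => // i _; have [_ _ h] := hB i; exact: h.
rewrite nneseriesZl; last by move=> i _; exact: poweR_ge0.
by rewrite -lee_pdivrMl // mule1.
Qed.

Lemma hausdorff_dim_ge (R : realType) (X : Type) (dist : X -> X -> R)
    (A : set X) (T : R) :
  (forall s, 0 < s -> s < T -> (0 < hausdorff_measure dist s A)%E) ->
  (T%:E <= hausdorff_dim dist A)%E.
Proof.
move=> h; apply: le_ereal_inf_tmp => _ /= [s [s0 Hs] <-].
rewrite lee_fin leNgt; apply/negP => /(h _ s0).
by rewrite Hs ltxx.
Qed.

(** * Cantor sets near sparse sequences of rationals *)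

Lemma expr_eventually_ge (R : realType) (x K : R) : 1 < x ->
  exists n0 : nat, forall n, (n0 <= n)%N -> K <= x ^+ n.
Proof.
move=> x1; pose n0 := (Num.truncn (`|K| / (x - 1))).+1.
have h0 : 0 < x - 1 by lra.
have bern n : 1 + n%:R * (x - 1) <= x ^+ n.
  elim: n => [|n IH]; first by rewrite mul0r addr0 expr0.
  rewrite exprS -natr1; have n0' : 0 <= n%:R :> R by [].
  have := ler_wpM2l (ltW (lt_trans ltr01 x1)) IH.
  have := mulr_ge0 n0' (sqr_ge0 (x - 1)); rewrite expr2; lra.
exists n0 => n n0n; apply: le_trans (bern n).
have /truncn_itv/andP[_ h1] : 0 <= `|K| / (x - 1) by rewrite divr_ge0 // ltW.
have h2 : `|K| / (x - 1) < n%:R by apply: lt_le_trans h1 _; rewrite ler_nat.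
rewrite ltr_pdivrMr // in h2.
have := ler_norm K; lra.
Qed.

Lemma exprD_eventually_le (R : realType) (x y K : R) : 0 < x -> x < y ->
  exists n0 : nat, forall n, (n0 <= n)%N -> K * x ^+ n <= y ^+ n.
Proof.
move=> x0 xy; have [|n0 h] := @expr_eventually_ge R (y / x) K.
  by rewrite ltr_pdivlMr // mul1r.
exists n0 => n /h; rewrite expr_div_n ler_pdivlMr //; exact: exprn_gt0.
Qed.

Lemma powR_exprn (R : realType) (x t : R) (n : nat) : 0 <= x ->
  (x ^+ n) `^ t = (x `^ t) ^+ n.
Proof.
by move=> x0; rewrite -powR_mulrn // -powRrM mulrC powRrM powR_mulrn ?powR_ge0.
Qed.

Lemma radius_eventually (R : realType) (a c y z t K : R) :
  0 < a -> 0 < c -> 0 < y -> 1 < y `^ t * z ->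
  \forall n \near \oo, K <= (c * y ^+ n) `^ t * (a * z ^+ n).
Proof.
move=> a0 c0 y0 h.
have ca0 : 0 < c `^ t * a by rewrite mulr_gt0 // powR_gt0.
have [n0 hn] := expr_eventually_ge (K / (c `^ t * a)) h.
exists n0 => // n /= /hn; rewrite ler_pdivrMr //.
rewrite powRM ?(ltW c0) ?exprn_ge0 ?(ltW y0) // powR_exprn ?(ltW y0) //.
rewrite exprMn => /le_trans; apply.
by rewrite le_eqVlt; apply/orP; left; apply/eqP; ring.
Qed.

Lemma fast_subsequence (P : nat -> nat -> Prop) (start : nat) :
  (forall n, \forall m \near \oo, P n m) ->
  exists nu : nat -> nat,
    forall k, (start + k <= nu k)%N /\ P (nu k) (nu k.+1).
Proof.
move=> nearP.
have /choice[G hG] n : exists n0, forall m, (n0 <= m)%N -> P n m.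
  by have [n0 _ h] := nearP n; exists n0.
pose nu := fix nu k := if k is k'.+1 then maxn (nu k').+1 (G (nu k')) else start.
exists nu => k; split; last by apply: hG; rewrite leq_maxr.
elim: k => [|k IH]; first by rewrite addn0.
by rewrite addnS /= leq_max ltnS IH.
Qed.

(** Growth condition for choosing the scale m after the scale n: there the spacing
p/z^m must be so small, compared with the length of the current cell (c y^n, or
l at the start), that the number of children exceeds the negative power
(c y^m)^(-t) of the new length. *)
Definition nested_radii (R : realType) (p : nat) (c y z l t : R)
    (n m : nat) : Prop :=
  8 <= (c * y ^+ m) `^ t * (l / p%:R * z ^+ m) /\
  8 <= (c * y ^+ m) `^ t * (c * y ^+ n / p%:R * z ^+ m).

Lemma nested_radii_near (R : realType) (p : nat) (c y z l t : R) (n : nat) :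
  (0 < p)%N -> 0 < c -> 0 < y -> 0 < l -> 1 < y `^ t * z ->
  \forall m \near \oo, nested_radii p c y z l t n m.
Proof.
move=> p0 c0 y0 l0 h; have pR0 : 0 < p%:R :> R by rewrite ltr0n.
near=> m; split; near: m; apply: radius_eventually => //.
  by rewrite divr_gt0.
by rewrite divr_gt0 // mulr_gt0 // exprn_gt0.
Unshelve. all: by end_near. Qed.

(** The instance Q = z^n/p, off = 1/p of the Cantor construction: the left endpoints
of the cells are then the fractions (i + 1/p)/Q = (p i + 1)/z^n, with numerators
congruent to 1 modulo p. *)
Lemma cantor_near_rationals (R : realType) (p : nat) (c y z y0 l t : R)
    (nu : nat -> nat) :
  (0 < p)%N -> 0 < c -> 2 * c <= 1 -> 0 < y <= 1 -> 0 < z -> y * z <= 1 ->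
  0 <= y0 -> 0 < l -> 0 <= t <= 1 ->
  (forall k, nested_radii p c y z l t (nu k) (nu k.+1)) ->
  exists (h : R -> R) (C : R), [/\ 0 <= C,
    forall u : R, 0 <= u < 1 -> y0 <= h u <= y0 + l,
    forall (u : R) (k : nat), 0 <= u < 1 -> exists i : nat,
      `|h u - (p * i + 1)%:R / z ^+ nu k.+1| <= c * y ^+ nu k.+1 &
    forall u v : R, 0 <= u < 1 -> 0 <= v < 1 -> `|u - v| <= C * `|h u - h v| `^ t].
Proof.
move=> p0 c0 c1 /andP[y_gt0 y1] z0 yz y00 l0 t01 hnu.
have /andP[t0 t1] := t01.
have pR : 1 <= p%:R :> R by rewrite ler1n.
have pR0 : 0 < p%:R :> R by lra.
pose rho k := if k is k'.+1 then c * y ^+ nu k else l.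
pose Q k := z ^+ nu k / p%:R.
pose off : R := p%:R^-1.
have off01 : 0 <= off <= 1.
  by rewrite invr_ge0 ltW //= invf_le1.
have yn0 n : 0 < y ^+ n by exact: exprn_gt0.
have zn0 n : 0 < z ^+ n by exact: exprn_gt0.
have rho_gt0 k : 0 < rho k by case: k => [|k] //=; rewrite mulr_gt0.
have Q_gt0 k : 0 < Q k by rewrite divr_gt0.
have rhoQ_le k : 2 * rho k.+1 * Q k.+1 <= 1.
  have -> : 2 * rho k.+1 * Q k.+1 = (2 * c) * ((y * z) ^+ nu k.+1 / p%:R).
    by rewrite /Q /rho exprMn; field; rewrite gt_eqF.
  rewrite -[leRHS]mulr1; apply: ler_pM => //; first lra.
    by rewrite divr_ge0 // exprn_ge0 // mulr_ge0 // ltW.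
  rewrite ler_pdivrMr // mul1r; apply: le_trans pR.
  by rewrite exprn_ile1 // mulr_ge0 // ltW.
have rhoQ k : 8 <= rho k.+1 `^ t * (rho k * Q k.+1).
  rewrite (_ : rho k * Q k.+1 = rho k / p%:R * z ^+ nu k.+1); last by rewrite /Q; ring.
  by have [h1 h2] := hnu k; case: k h1 h2.
have rhoQ_exp k : 4 <= rho k.+1 `^ t * (rho k * Q k.+1).
  by have := rhoQ k; lra.
have rhoQ_ge k : 8 <= rho k * Q k.+1.
  have rQ0 : 0 <= rho k * Q k.+1 by rewrite ltW // mulr_gt0.
  apply: le_trans (rhoQ k) _; rewrite ler_piMl //.
  have r1 : rho k.+1 <= 1.
    rewrite /rho -[leRHS]mulr1; apply: ler_pM; [lra|exact: ltW|lra|].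
    by rewrite exprn_ile1 // ltW.
  have <- : 1 `^ t = 1 :> R by rewrite powR1.
  by rewrite ge0_ler_powR // ?nnegrE // ltW.
exists (cantor_point off y0 Q rho), (16 * (1 + rho 0 `^ (- t))); split.
- by rewrite mulr_ge0 // addr_ge0 // powR_ge0.
- move=> u u01; exact: (@cantor_point_itv _ _ _ _ _ off01 y00 rho_gt0 Q_gt0
    rhoQ_le rhoQ_ge u 0).
- move=> u k u01; have [i /andP[h1 h2]] := @cantor_point_approx _ _ _ _ _
    off01 y00 rho_gt0 Q_gt0 rhoQ_le rhoQ_ge u k u01.
  exists i; have iE : (i%:R + off) / Q k.+1 = (p * i + 1)%:R / z ^+ nu k.+1.
    by rewrite /Q /off natrD natrM; field; rewrite !gt_eqF.
  rewrite iE in h1 h2; rewrite ger0_norm; first by rewrite lerBlDl.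
  by rewrite subr_ge0.
- move=> u v u01 v01; exact: cantor_point_separation.
Qed.

Lemma rational_between (R : realType) (lo hi : R) : 0 <= lo -> lo < hi ->
  exists A B : nat, [/\ (0 < A)%N, (0 < B)%N, lo * B%:R < A%:R & A%:R < hi * B%:R].
Proof.
move=> lo0 lohi; have d0 : 0 < hi - lo by lra.
pose B := (Num.truncn (hi - lo)^-1).+1.
have B1 : 1 < (hi - lo) * B%:R.
  have /truncn_itv/andP[_ h] : 0 <= (hi - lo)^-1 by rewrite invr_ge0 ltW.
  by rewrite mulrC -ltr_pdivrMr // div1r.
have /truncn_itv/andP[h1 h2] : 0 <= lo * B%:R by rewrite mulr_ge0.
exists (Num.truncn (lo * B%:R)).+1, B; split => //.
by rewrite -natr1; lra.
Qed.

(** * A criterion for large Weyl sums *)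

Lemma powR_gt1 (R : realType) (a r : R) : 1 < a -> 0 < r -> 1 < a `^ r.
Proof.
move=> a1 r0; have <- : 1 `^ r = 1 :> R by rewrite powR1.
by rewrite gt0_ltr_powR // nnegrE; lra.
Qed.

Lemma euclidean_dist_ge0 (R : realType) (d : nat) (x y : 'rV[R]_d) :
  0 <= euclidean_dist d x y.
Proof. exact: sqrtr_ge0. Qed.

Lemma coord_le_euclidean_dist (R : realType) (d : nat) (x y : 'rV[R]_d) j :
  `|x ord0 j - y ord0 j| <= euclidean_dist d x y.
Proof.
rewrite /euclidean_dist -sqrtr_sqr ler_sqrt; last first.
  by apply: sumr_ge0 => i _; exact: sqr_ge0.
rewrite (bigD1 j) //= lerDl; apply: sumr_ge0 => i _; exact: sqr_ge0.
Qed.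

(** The middle third of a cube, in each coordinate, avoids the question which faces
belong to the cube. *)
Lemma cube_interior (R : realType) (d : nat) (Q : set 'rV[R]_d) :
  is_cube Q -> Q `<=` torus d ->
  exists (y : 'rV[R]_d) (l : R), [/\ 0 < l, forall j, 0 <= y ord0 j &
    forall x : 'rV[R]_d,
      (forall j, y ord0 j <= x ord0 j <= y ord0 j + l) -> Q x].
Proof.
move=> [a [l [b [c [l0 ->]]]]] Qt.
pose y := \row_(j < d) (a ord0 j + l / 3).
have yQ (x : 'rV[R]_d) : (forall j, y ord0 j <= x ord0 j <= y ord0 j + l / 3) ->
    forall j, x ord0 j \in Interval (BSide (b j) (a ord0 j))
      (BSide (c j) (a ord0 j + l)).
  move=> xy j; have := xy j; rewrite mxE => /andP[h1 h2].
  by rewrite in_itv; case: (b j); case: (c j) => /=; apply/andP; split; lra.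
exists y, (l / 3); split=> //; first by lra.
move=> j; have /Qt/(_ j)/andP[] // : [set x | forall j : 'I_d,
    x ord0 j \in Interval (BSide (b j) (a ord0 j)) (BSide (c j) (a ord0 j + l))] y.
by apply: yQ => i; apply/andP; split; lra.
Qed.

Lemma large_weyl_set_mono (R : realType) (alpha beta : R) (d : nat) :
  0 <= alpha -> alpha <= beta -> large_weyl_set beta d `<=` large_weyl_set alpha d.
Proof.
move=> a0 ab x [tx inf]; split=> //.
(* N = 0 is discarded: powers of 0 do not increase with the exponent. *)
have inf' : infinite_set ([set N : nat | N%:R `^ beta <= Normc.normc (weyl_sum x N)]
    `\ 0%N).
  by apply: infinite_setD => //; exact: finite_set1.
apply: sub_infinite_set inf' => N [/= hN /eqP N0]; apply: le_trans hN.
by apply: ler_powR => //; rewrite ler1n lt0n.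
Qed.

(** With q = p^((D+1)An) and N = p^(Bn), a multiple of q, the sum at r is
N p^(-An) = p^((B-A)n), which eventually exceeds 2 N^alpha = 2 p^(alpha B n). *)
Lemma large_weyl_of_rationals (R : realType) (alpha : R) (D p A B : nat)
    (x : 'rV[R]_D.+1) (nu : nat -> nat) :
  0 < alpha -> (1 < p)%N -> (0 < B)%N -> (D.+1 * A <= B)%N ->
  alpha * B%:R < B%:R - A%:R -> torus D.+1 x ->
  (forall k, k <= nu k.+1)%N ->
  (forall k, exists r : 'rV[R]_D.+1,
     (forall L, Normc.normc (weyl_sum r (p ^ (D.+1 * (A * nu k.+1)) * L)) =
        L%:R * (p ^ (D * (A * nu k.+1)))%:R) /\
     \sum_(j < D.+1) `|x ord0 j - r ord0 j| *
       (p ^ (B * nu k.+1))%:R ^+ j.+1 <= (4 * pi)^-1) ->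
  large_weyl_set alpha D.+1 x.
Proof.
move=> a0 p1 B0 AB aAB tx nuk hr; apply: large_weyl_set_nearby => // K.
have pR : 1 < p%:R :> R by rewrite ltr1n.
have pR0 : 0 < p%:R :> R by lra.
pose w : R := (p ^ B)%:R `^ alpha.
have wE : w = p%:R `^ (alpha * B%:R).
  by rewrite /w natrX -powR_mulrn ?(ltW pR0) // -powRrM mulrC.
have w1 : 1 < w by rewrite wE; apply: powR_gt1 => //; rewrite mulr_gt0 ?ltr0n.
have AB' : (A <= B)%N by apply: leq_trans AB; rewrite leq_pmull.
have wv : w < (p ^ (B - A))%:R.
  rewrite natrX -powR_mulrn ?(ltW pR0) // natrB // wE.
  rewrite -(subrK (alpha * B%:R) (B%:R - A%:R)) powRD; last first.
    by rewrite (gt_eqF pR0) implybT.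
  rewrite ltr_pMl ?powR_gt0 //; apply: powR_gt1 => //; lra.
have [n1 h1] := expr_eventually_ge K%:R w1.
have [n2 h2] := exprD_eventually_le 2 (lt_trans ltr01 w1) wv.
pose k := maxn n1 n2; have [r [rS rx]] := hr k.
set n := nu k.+1 in rS rx.
have kn : (maxn n1 n2 <= n)%N by exact: nuk.
have NE : (p ^ (B * n))%:R `^ alpha = w ^+ n.
  by rewrite expnM natrX powR_exprn.
exists (p ^ (B * n))%N, r; split.
- by rewrite NE; apply/h1/(leq_trans _ kn)/leq_maxl.
- rewrite NE; apply: le_trans (h2 n _) _; first exact/(leq_trans _ kn)/leq_maxr.
  have -> : (p ^ (B * n) = p ^ (D.+1 * (A * n)) * p ^ ((B - D.+1 * A) * n))%N.
    by rewrite -expnD; congr (_ ^ _)%N; nia.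
  rewrite rS -natrM -expnD -natrX -expnM ler_nat leq_exp2l //; nia.
- rewrite mulrC -ler_pdivlMr ?mul1r //.
  by rewrite mulr_gt0 // pi_gt0.
Qed.

(** * The quadratic case *)

Lemma powR_radius_gt1 (R : realType) (p a b : nat) (t : R) :
  (1 < p)%N -> t * b%:R < a%:R -> 1 < ((p%:R : R) ^- b) `^ t * p%:R ^+ a.
Proof.
move=> p1 h; have pR : 1 < p%:R :> R by rewrite ltr1n.
have pR0 : 0 < p%:R :> R by lra.
rewrite -powR_invn ?(ltW pR0) // -powRrM -powR_mulrn ?(ltW pR0) // -powRD; last first.
  by rewrite (gt_eqF pR0) implybT.
by apply: powR_gt1 => //; lra.
Qed.

Lemma invX_le1 (R : realType) (p b : nat) : (0 < p)%N ->
  0 < (p%:R : R) ^- b <= 1.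
Proof.
move=> p0; rewrite invr_gt0 exprn_gt0 ?ltr0n //= invf_le1 ?exprn_gt0 ?ltr0n //.
by rewrite exprn_ege1 // ler1n.
Qed.

Lemma invXM_le1 (R : realType) (p a b : nat) : (0 < p)%N -> (a <= b)%N ->
  (p%:R : R) ^- b * p%:R ^+ a <= 1.
Proof.
move=> p0 ab; rewrite mulrC ler_pdivrMr ?exprn_gt0 ?ltr0n // mul1r.
by rewrite ler_weXn2l // ler1n.
Qed.

Lemma inv8pi_bounds (R : realType) :
  0 < ((8 * pi)^-1 : R) /\ 2 * ((8 * pi)^-1 : R) <= 1.
Proof.
have h := pi_ge2 R; split; first by rewrite invr_gt0; lra.
by rewrite -div1r mulrA mulr1 ler_pdivrMr; lra.
Qed.

Lemma inv4piE (R : realType) :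
  (4 * pi)^-1 = (8 * pi)^-1 + (8 * pi)^-1 :> R.
Proof.
have h (x : R) : x != 0 -> (4 * x)^-1 = (8 * x)^-1 + (8 * x)^-1.
  by move=> x0; field.
by apply: h; rewrite gt_eqF // pi_gt0.
Qed.

Lemma normc_nat (R : realType) (n : nat) : Normc.normc (n%:R : R[i]) = n%:R.
Proof.
rewrite -[n%:R]mulr_natl mulr1 -(rmorph_nat (@real_complex R)) /=.
by rewrite expr0n addr0 sqrtr_sqr normr_nat.
Qed.

Lemma coprime_mulD1 (p i : nat) : coprime p (p * i + 1).
Proof. by rewrite -coprime_modr mulnC modnMDl coprime_modr coprimen1. Qed.

Lemma radius_mulX (R : realType) (c : R) (p b n : nat) (x : R) : (0 < p)%N ->
  `|x| <= c * ((p%:R ^- b) ^+ n) -> `|x| * (p ^ (b * n))%:R <= c.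
Proof.
move=> p0 h; have N0 : 0 < (p ^ (b * n))%:R :> R by rewrite ltr0n expn_gt0 p0.
by rewrite -ler_pdivlMr //; move: h; rewrite exprVn -exprM -natrX.
Qed.

Lemma le_mul_powR_dist (R : realType) (C C' d d' t x : R) :
  0 <= C -> C <= C' -> 0 <= t -> 0 <= d -> d <= d' ->
  x <= C * d `^ t -> x <= C' * d' `^ t.
Proof.
move=> C0 CC t0 d0 dd h; apply: le_trans h _; apply: ler_pM => //.
  exact: powR_ge0.
by rewrite ge0_ler_powR // nnegrE //; exact: le_trans d0 dd.
Qed.

(** The two coordinates have Hoelder exponents 2s/3 and s/3, matching the dimensions
2A/B and A/B of the two Cantor sets when A/B is slightly larger than s/3. *)
Lemma hausdorff_dim_quadratic (R : realType) (alpha : R) (Q : set 'rV[R]_2) :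
  0 < alpha -> alpha < 1 -> is_cube Q -> Q `<=` torus 2 ->
  ((Num.min (3 / 2) (3 * (1 - alpha)))%:E <=
      hausdorff_dim (euclidean_dist 2) (large_weyl_set alpha 2 `&` Q))%E.
Proof.
move=> a0 a1 cQ Qt; apply: hausdorff_dim_ge => s s0 sT.
(* The bound is constant for alpha <= 1/2, so alpha may be raised to beta. *)
pose beta := Num.max alpha (1 / 2).
have ab : alpha <= beta by rewrite le_max lexx.
have b12 : 1 / 2 <= beta by rewrite le_max lexx orbT.
have b1 : beta < 1 by rewrite gt_max a1; lra.
have sb : s < 3 * (1 - beta).
  move: sT; rewrite lt_min => /andP[s1 s2].
  by rewrite /beta; case: (leP alpha (1 / 2)) => _; lra.
have [||A [B [A0 B0 sAB ABb]]] := @rational_between R (s / 3) (1 - beta) _ _.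
- by lra.
- by lra.
have AB2 : (2 * A <= B)%N.
  rewrite -(ler_nat R) natrM; have : 0 <= B%:R :> R by []. nra.
have [c0 c1] := inv8pi_bounds R; set c : R := (8 * pi)^-1 in c0 c1.
have [y [l [l0 y0 yQ]]] := cube_interior cQ Qt.
pose z : R := 3 ^+ (2 * A).
have z0 : 0 < z by exact: exprn_gt0.
pose r1 : R := 3 ^- B; pose r2 : R := 3 ^- (2 * B).
have hr1 : 0 < r1 <= 1 by exact: (invX_le1 R B (isT : 0 < 3)%N).
have hr2 : 0 < r2 <= 1 by exact: (invX_le1 R (2 * B) (isT : 0 < 3)%N).
have r1z : r1 * z <= 1 by exact: (invXM_le1 R (isT : 0 < 3)%N).
have r2z : r2 * z <= 1.
  apply: (@invXM_le1 R 3 (2 * A) (2 * B)) => //.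
  by rewrite leq_mul2l /= (leq_trans _ AB2) // leq_pmull.
have g1 : 1 < r1 `^ (2 * s / 3) * z.
  by apply: (@powR_radius_gt1 R 3 (2 * A) B) => //; rewrite natrM; lra.
have g2 : 1 < r2 `^ (s / 3) * z.
  by apply: (@powR_radius_gt1 R 3 (2 * A) (2 * B)) => //; rewrite !natrM; lra.
have hnear n : \forall m \near \oo, nested_radii 3 c r1 z l (2 * s / 3) n m /\
    nested_radii 3 c r2 z l (s / 3) n m.
  have /andP[r10 _] := hr1; have /andP[r20 _] := hr2.
  by apply: filterI; apply: nested_radii_near.
have [nu hnu] := fast_subsequence 0 hnear.
have [|h1 [C1 [C10 h1itv h1app h1sep]]] := @cantor_near_rationals R 3 c r1 z
  (y ord0 ord0) l (2 * s / 3) nu isT c0 c1 hr1 z0 r1z (y0 _) l0 _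
  (fun k => proj1 (hnu k).2); first by apply/andP; split; lra.
have [|h2 [C2 [C20 h2itv h2app h2sep]]] := @cantor_near_rationals R 3 c r2 z
  (y ord0 ord_max) l (s / 3) nu isT c0 c1 hr2 z0 r2z (y0 _) l0 _
  (fun k => proj2 (hnu k).2); first by apply/andP; split; lra.
pose x u v : 'rV[R]_2 := \row_j (if j == ord0 then h1 u else h2 v).
have -> : s = 2 * s / 3 + s / 3 by lra.
apply: (@hausdorff_measure_gt0 _ _ _ _ x (C1 + C2)).
- exact: euclidean_dist_ge0.
- exact: addr_ge0.
- by lra.
- by lra.
- by lra.
- move=> u v u01 v01.
  have xQ : Q (x u v).
    apply: yQ => j; rewrite mxE; case: eqP => [->|/eqP j0]; first exact: h1itv.
    have -> : j = ord_max by apply: val_inj; move: j j0 => [[|[|]]].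
    exact: h2itv.
  split=> //; apply: (@large_weyl_set_mono _ _ beta); rewrite ?(ltW a0) //.
  apply: (@large_weyl_of_rationals _ _ 1 3 A B _ nu) => //.
  + by lra.
  + by lra.
  + exact: Qt.
  + by move=> k; have [h _] := hnu k.+1; apply: leq_trans h; rewrite add0n.
  move=> k; have [i1 hi1] := h1app u k u01; have [i2 hi2] := h2app v k v01.
  have zE : z ^+ nu k.+1 = (3 ^ (2 * (A * nu k.+1)))%:R.
    by rewrite /z -exprM natrX mulnA.
  rewrite zE in hi1 hi2; set q := (3 ^ (2 * (A * nu k.+1)))%N in hi1 hi2 *.
  have q0 : (0 < q)%N by rewrite expn_gt0.
  exists (\row_j (if j == ord0 then (3 * i1 + 1)%:R / q%:R
                  else (3 * i2 + 1)%:R / q%:R)).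
  split.
    move=> L; rewrite (@weyl_sum_rational _ _ _
      (fun n => (3 * i1 + 1) * n + (3 * i2 + 1) * n ^ 2)%N).
    + rewrite Normc.normcM; congr (_ * _).
        exact: normc_nat.
      apply: (@pexpIrn _ 2) => //; rewrite ?nnegrE ?normc_ge0 //.
      rewrite (@normc_quadratic_gauss_sum R) //.
        by rewrite -natrX -expnM mul1n mulnC.
      by rewrite coprimeXl // coprimeMr coprime_mulD1.
    + move=> n; rewrite !big_ord_recl big_ord0 !mxE /= addr0 natrD !natrM natrX; ring.
    + move=> n; set i := (3 * i1 + 1)%N; set j := (3 * i2 + 1)%N.
      have -> : (i * (n + q) + j * (n + q) ^ 2 =
          (i + 2 * j * n + j * q) * q + (i * n + j * n ^ 2))%N by ring.
      exact: modnMDl.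
  rewrite !big_ord_recl big_ord0 !mxE /= addr0.
  have b1' := @radius_mulX R c 3 B _ _ isT hi1.
  have b2' := @radius_mulX R c 3 (2 * B) _ _ isT hi2.
  rewrite (_ : (2 * B * nu k.+1 = B * nu k.+1 * 2)%N) in b2'; last by ring.
  rewrite expnM natrX in b2'.
  rewrite expr1 /bump /= .
  rewrite inv4piE; exact: lerD.
- move=> u v u' v' u01 v01 u'01 v'01.
  have dx := coord_le_euclidean_dist (x u v) (x u' v').
  split.
  + apply: le_mul_powR_dist (h1sep _ _ u01 u'01) => //; rewrite ?lerDl //; first lra.
    by have := dx ord0; rewrite !mxE.
  + apply: le_mul_powR_dist (h2sep _ _ v01 v'01) => //; rewrite ?lerDr //; first lra.
    by have := dx ord_max; rewrite !mxE.
Qed.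

(** * Degree at least three *)

(** The two members of the minimum cross at nu = 2d/3, where both equal 3/(4d). *)
Lemma kappa_le (R : realType) (d : nat) : (0 < d)%N ->
  kappa d <= 3 / (4 * d%:R) :> R.
Proof.
move=> d0; have dR : 0 < d%:R :> R by rewrite ltr0n.
rewrite /kappa big_nat_cond; apply: bigmax_le.
  by rewrite divr_ge0 // mulr_ge0 // ltW.
move=> nu /andP[/andP[nu1 nud] _].
have nR : 0 < nu%:R :> R by rewrite ltr0n.
have d40 : 0 < 4 * d%:R :> R by lra.
have nd : nu%:R <= d%:R :> R by rewrite ler_nat.
rewrite ge_min; case: (leP (2 * d%:R) (3 * nu%:R : R)) => h; apply/orP.
  left; have n0 : 0 < 2 * nu%:R :> R by lra.
  by rewrite ler_pdivrMr // mulrAC ler_pdivlMr // mul1r; lra.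
right; have n0 : 0 < 2 * d%:R - nu%:R :> R by lra.
by rewrite ler_pdivrMr // mulrAC ler_pdivlMr // mul1r; lra.
Qed.

Lemma p_adic_approx (R : realType) (p : nat) (l : R) : (1 < p)%N -> 0 < l ->
  exists t : nat, forall x : R, 0 <= x ->
    exists b : nat, x <= b%:R / (p ^ t)%:R <= x + l.
Proof.
move=> p1 l0; have [|t ht] := @expr_eventually_ge R p%:R l^-1.
  by rewrite ltr1n.
exists t => x x0; have pt0 : 0 < (p ^ t)%:R :> R.
  by rewrite ltr0n expn_gt0 ltnW.
have /truncn_itv/andP[h1 h2] : 0 <= x * (p ^ t)%:R by rewrite mulr_ge0 // ltW.
exists (Num.truncn (x * (p ^ t)%:R)).+1.
rewrite ler_pdivlMr // ler_pdivrMr // (ltW h2) /= mulrDl -natr1.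
apply: lerD => //; have := ht t (leqnn _).
by rewrite -natrX -div1r ler_pdivrMr // mulrC.
Qed.

(** Only the last coordinate varies, so the map from the square ignores its second
argument, which receives the exponent 0. The other coordinates are fixed
fractions with denominator p^t inside the cube; starting the sparse sequence at
t makes p^t divide p^(An). *)
Lemma hausdorff_dim_monomial (R : realType) (alpha : R) (D : nat)
    (Q : set 'rV[R]_D.+1) :
  (2 <= D)%N -> 0 < alpha -> alpha < 1 -> is_cube Q -> Q `<=` torus D.+1 ->
  ((Num.min (kappa D.+1) (2 * kappa D.+1 * (1 - alpha)))%:E <=
      hausdorff_dim (euclidean_dist D.+1) (large_weyl_set alpha D.+1 `&` Q))%E.
Proof.
move=> D2 a0 a1 cQ Qt; apply: hausdorff_dim_ge => s s0 sT.
(* The bound is constant for alpha <= 1/2, so alpha may be raised to beta. *)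
pose beta := Num.max alpha (1 / 2).
have ab : alpha <= beta by rewrite le_max lexx.
have b12 : 1 / 2 <= beta by rewrite le_max lexx orbT.
have b1 : beta < 1 by rewrite gt_max a1; lra.
have dR : 3 <= D.+1%:R :> R by rewrite ler_nat.
have dV0 : 0 < (D.+1%:R)^-1 :> R by rewrite invr_gt0; lra.
have dV : (D.+1%:R)^-1 <= 3^-1 :> R by rewrite lef_pV2 // posrE; lra.
have kle : kappa D.+1 <= 3 / 4 * (D.+1%:R)^-1 :> R.
  by apply: le_trans (kappa_le R (isT : 0 < D.+1)%N) _; rewrite invfM mulrA.
have k14 : kappa D.+1 <= 1 / 4 :> R.
  apply: le_trans kle _.
  have := ler_wpM2l (_ : 0 <= 3 / 4 :> R) dV.
  rewrite (_ : 3 / 4 * 3^-1 = 1 / 4 :> R); last by field.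
  by apply; lra.
have sb : s < 2 * kappa D.+1 * (1 - beta).
  move: sT; rewrite lt_min => /andP[s1 s2].
  by rewrite /beta; case: (leP alpha (1 / 2)) => _; lra.
have k0 : 0 < kappa D.+1 :> R.
  rewrite ltNge; apply/negP => k0.
  have : 0 <= - kappa D.+1 * (1 - beta) by rewrite mulr_ge0; lra.
  by lra.
have sk : s < kappa D.+1.
  have : 0 <= kappa D.+1 * (beta - 1 / 2) by rewrite mulr_ge0; lra.
  by lra.
have sb1 : s < 1 - beta.
  have : 0 <= (1 / 4 - kappa D.+1) * (1 - beta) by rewrite mulr_ge0; lra.
  by lra.
(* A/B < 1/d gives dA <= B, and A/B > s is the dimension of the Cantor set. *)
have [||A [B [A0 B0 sAB ABm]]] :=
    @rational_between R s (Num.min (D.+1%:R)^-1 (1 - beta)) _ _.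
- exact: ltW.
- rewrite lt_min sb1 andbT; apply: lt_le_trans sk (le_trans kle _).
  by rewrite ler_piMl ?(ltW dV0) //; lra.
have BR : 0 < B%:R :> R by rewrite ltr0n.
have ABb : A%:R < (1 - beta) * B%:R.
  by apply: lt_le_trans ABm _; rewrite ler_pM2r // ge_min lexx orbT.
have ABD : (D.+1 * A <= B)%N.
  rewrite -(ler_nat R) natrM mulrC -ler_pdivlMr; last by lra.
  rewrite mulrC; apply/ltW; apply: lt_le_trans ABm _.
  by rewrite ler_pM2r // ge_min lexx.
have [p Dp pp] := prime_above D.+1.
have p1 := prime_gt1 pp; have p0 := prime_gt0 pp.
have [c0 c1] := inv8pi_bounds R; set c : R := (8 * pi)^-1 in c0 c1.
have [y [l [l0 y0 yQ]]] := cube_interior cQ Qt.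
have [t ht] := p_adic_approx p1 l0.
have /choice[b hb] (j : 'I_D.+1) : exists b : nat,
    y ord0 j <= b%:R / (p ^ t)%:R <= y ord0 j + l by exact: ht.
pose z : R := p%:R ^+ (D.+1 * A); pose r : R := p%:R ^- (D.+1 * B).
have pR0 : 0 < p%:R :> R by rewrite ltr0n.
have z0 : 0 < z by exact: exprn_gt0.
have hr : 0 < r <= 1 by exact: invX_le1.
have AB : (A <= B)%N by apply: leq_trans ABD; rewrite leq_pmull.
have rz : r * z <= 1 by apply: invXM_le1; rewrite // leq_mul2l AB orbT.
have g : 1 < r `^ s * z.
  apply: powR_radius_gt1 => //; rewrite !natrM mulrCA ltr_pM2l //; lra.
have hnear n : \forall m \near \oo, nested_radii p c r z l s n m.
  by have /andP[r0 _] := hr; exact: nested_radii_near.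
have [nu hnu] := fast_subsequence t hnear.
have [|h [C [C0 hitv happ hsep]]] := @cantor_near_rationals R p c r z
  (y ord0 ord_max) l s nu p0 c0 c1 hr z0 rz (y0 _) l0 _
  (fun k => (hnu k).2); first by apply/andP; split; lra.
pose x (u v : R) : 'rV[R]_D.+1 :=
  \row_j (if j == ord_max then h u else (b j)%:R / (p ^ t)%:R).
have -> : s = s + 0 by rewrite addr0.
apply: (@hausdorff_measure_gt0 _ _ _ _ x (C + 1)).
- exact: euclidean_dist_ge0.
- exact: addr_ge0.
- exact: ltW.
- by [].
- by rewrite addr0.
- move=> u v u01 v01.
  have xQ : Q (x u v).
    apply: yQ => j; rewrite mxE; case: eqP => [->|_]; first exact: hitv.
    exact: hb.
  split=> //; apply: (@large_weyl_set_mono _ _ beta); rewrite ?(ltW a0) //.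
  apply: (@large_weyl_of_rationals _ _ D p A B _ nu) => //.
  + by lra.
  + by lra.
  + exact: Qt.
  + move=> k; have [h' _] := hnu k.+1; apply: leq_trans h'.
    by rewrite addnS ltnW // ltnS leq_addl.
  have not_last (j : 'I_D) : (widen_ord (leqnSn D) j == ord_max) = false.
    by apply/eqP => /(congr1 val) /= jD; have := ltn_ord j; rewrite jD ltnn.
  move=> k; have [i hi] := happ u k u01.
  have tk : (t <= A * nu k.+1)%N.
    have [h' _] := hnu k.+1; apply: leq_trans (leq_trans (leq_addr _ _) h') _.
    by rewrite leq_pmull.
  have zE : z ^+ nu k.+1 = (p ^ (D.+1 * (A * nu k.+1)))%:R.
    by rewrite /z -exprM natrX mulnA.
  rewrite zE in hi; set q := (p ^ (D.+1 * (A * nu k.+1)))%N in hi *.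
  set K := (A * nu k.+1)%N in tk q zE hi *.
  have qE : q = (p ^ (D * K) * p ^ (K - t) * p ^ t)%N.
    have -> : q = (p ^ (D * K + (K - t) + t))%N.
      by rewrite -addnA subnK // addnC -mulSn.
    by rewrite !expnD.
  exists (\row_j (if j == ord_max then (p * i + 1)%:R / q%:R
                  else (b j)%:R / (p ^ t)%:R)).
  split.
    move=> L; rewrite (@weyl_sum_rational _ _ _
      (sparse_poly p (p * i + 1) D K (fun j => b (inord j) * p ^ (K - t))%N)).
    + rewrite sum_sparse_poly //.
      * by rewrite -natrM !normc_nat natrM.
      * rewrite coprimeMr coprime_mulD1 /= prime_coprime //.
        by rewrite gtnNdvd.
      * exact: ltnW.
    + move=> n; rewrite big_ord_recr /= !mxE eqxx /sparse_poly.
      set a := (p * i + 1)%N; rewrite natrD mulrDl addrC.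
      congr (_ + _); first by rewrite natrM natrX mulrAC.
      rewrite natrM natr_sum mulr_sumr mulr_suml; apply: eq_bigr => j _.
      rewrite mxE not_last.
      have -> : widen_ord (leqnSn D) j = inord j.
        by apply: val_inj; rewrite /= inordK // ltnS ltnW.
      rewrite qE !natrM !natrX; field.
      by rewrite !expf_neq0 // gt_eqF.
    + by move=> n; exact: sparse_poly_periodic.
  rewrite big_ord_recr /= big1 ?add0r; last first.
    by move=> j _; rewrite !mxE not_last subrr normr0 mul0r.
  rewrite !mxE eqxx inv4piE -/c.
  have := @radius_mulX R c p (D.+1 * B) _ _ p0 hi.
  rewrite (_ : (D.+1 * B * nu k.+1 = B * nu k.+1 * D.+1)%N); last by ring.
  rewrite expnM natrX; lra.
- move=> u v u' v' u01 v01 u'01 v'01.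
  have dx := coord_le_euclidean_dist (x u v) (x u' v').
  split.
  + apply: le_mul_powR_dist (hsep _ _ u01 u'01) => //; rewrite ?lerDl ?(ltW s0) //.
    by have := dx ord_max; rewrite !mxE eqxx.
  + rewrite powRr0 mulr1.
    by rewrite ler_norml; apply/andP; split; lra.
Qed.

Theorem theorem1p5 (R : realType) (alpha : R) (alpha_gt0 : 0 < alpha)
    (alpha_lt1 : alpha < 1) :
  (forall Q : set 'rV[R]_2, is_cube Q -> Q `<=` torus 2 ->
     ((Num.min (3 / 2) (3 * (1 - alpha)))%:E <=
      hausdorff_dim (euclidean_dist 2)
        (large_weyl_set alpha 2 `&` Q))%E) /\
  (forall (d : nat) (Q : set 'rV[R]_d), (3 <= d)%N -> is_cube Q ->
     Q `<=` torus d ->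
     ((Num.min (kappa d) (2 * kappa d * (1 - alpha)))%:E <=
      hausdorff_dim (euclidean_dist d)
        (large_weyl_set alpha d `&` Q))%E).
Proof.
split=> [Q|[//|D] Q D2]; first exact: hausdorff_dim_quadratic.
exact: hausdorff_dim_monomial.
Qed.
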